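(* Let $0\le a_1\le a$ be integers, $a_0=a-a_1$, and let $\alpha,\beta,\gamma,\delta,\epsilon,\zeta\in\binom{[a]}{a_1}$ (i.e. $\mathrm{sort}(\alpha)=\mathrm{sort}(\beta)=\mathrm{sort}(\gamma)=\mathrm{sort}(\delta)=\mathrm{sort}(\epsilon)=\mathrm{sort}(\zeta)$). Then the number of hexagonal puzzles with boundary labels $\alpha,\beta,\gamma,\delta,\epsilon,\zeta$ is $$\mathrm{Hex}(\alpha,\beta,\gamma,\delta,\epsilon,\zeta)=\begin{cases}\dbinom{a}{a_1}&\text{if }\alpha=\beta=\gamma=\delta=\epsilon=\zeta=0^{a_0}1^{a_1},\\[2mm]0&\text{otherwise},\end{cases}$$ where $\dbinom{a}{a_1}$ is the usual binomial coefficient.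
   Context: Strings: $\binom{[n]}{k}$ denotes the set of binary strings (words in the symbols $0,1$) of length $n$ with exactly $k$ ones; $\mathrm{sort}(\lambda)=0^{n-k}1^k$ for $\lambda\in\binom{[n]}{k}$. Puzzles: work in the triangular lattice in the plane, whose unit edges make angles $0^\circ,60^\circ,120^\circ$ with the $x$-axis. Edge labels are the three symbols $0$, $1$, $10$ (where $10$ is a single symbol). A unit triangle (upward- or downward-pointing) with labeled edges is an allowed piece if its three labels read clockwise are $(0,0,0)$, $(1,1,1)$, or a cyclic rotation of $(1,0,10)$. Given a convex lattice polygon (sides along lattice directions) each of whose sides is labeled by a binary string, one symbol per unit edge, read clockwise around the polygon, a puzzle with this boundary is an assignment of labels to all unit lattice edges in the polygon which agrees with the prescribed labels on the boundary and for which every unit triangle in the polygon is an allowed piece. $\mathrm{Hex}(\alpha,\beta,\gamma,\delta,\epsilon,\zeta)$ is the number of puzzles on the regular hexagon of side length $a$ whose sides, in clockwise order SW, NW, North, NE, SE, South, are labeled respectively $\alpha,\beta,\gamma,\delta,\epsilon,\zeta$, each read clockwise. *)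

(* Defs.v *)
From HB Require Import structures.
From mathcomp Require Import all_boot.

Set Implicit Arguments.
Unset Strict Implicit.
Unset Printing Implicit Defensive.

(* The symbols 0 and 1 of a string are [false] and [true]. *)

Definition strings (n k : nat) : {set n.-tuple bool} :=
  [set s : n.-tuple bool | count_mem true s == k].

Inductive label := L0 | L1 | L10.

Definition label_code (l : label) : option bool :=
  match l with L0 => Some false | L1 => Some true | L10 => None end.

Definition label_decode (c : option bool) : label :=
  match c with Some false => L0 | Some true => L1 | None => L10 end.

Lemma label_codeK : cancel label_code label_decode.
Proof. by case. Qed.

HB.instance Definition _ := Finite.copy label (can_type label_codeK).

Definition label_of_bit (b : bool) : label := if b then L1 else L0.

Definition allowed_piece (t : label * label * label) : bool :=
  t \in [:: (L0, L0, L0); (L1, L1, L1);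
            (L1, L0, L10); (L0, L10, L1); (L10, L1, L0)].

(* The three directions 0, 60 and 120 degrees of unit lattice edges. *)
Inductive direction := D0 | D60 | D120.

Definition direction_code (d : direction) : option bool :=
  match d with D0 => Some false | D60 => Some true | D120 => None end.

Definition direction_decode (c : option bool) : direction :=
  match c with Some false => D0 | Some true => D60 | None => D120 end.

Lemma direction_codeK : cancel direction_code direction_decode.
Proof. by case. Qed.

HB.instance Definition _ := Finite.copy direction (can_type direction_codeK).

(* The pair (x, y) is the lattice point x * u + y * v, where u and v are the  *)
(* unit vectors at 0 and 60 degrees; points with negative coordinates are not *)
(* needed.                                                                    *)
Definition point : Type := (nat * nat)%type.

(* (d, x, y) is the edge of direction d of the upward unit triangle with      *)
(* lower left corner (x, y), i.e. with corners (x, y), (x+1, y), (x, y+1).    *)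
(* Every unit edge belongs to exactly one upward triangle of the lattice, so  *)
(* this indexing is unambiguous; that triangle may lie outside the hexagon.   *)
Definition lattice_edge : Type := (direction * nat * nat)%type.

Definition endpoints (e : lattice_edge) : seq point :=
  let: (d, x, y) := e in
  match d with
  | D0   => [:: (x, y); (x.+1, y)]
  | D60  => [:: (x, y); (x, y.+1)]
  | D120 => [:: (x.+1, y); (x, y.+1)]
  end.

(* In both cases the edges are listed clockwise: left, right, bottom for the  *)
(* upward triangle; right, left, top for the downward triangle with corners   *)
(* (x+1, y), (x, y+1), (x+1, y+1).                                            *)
Definition up_triangle (x y : nat) : lattice_edge * lattice_edge * lattice_edge :=
  ((D60, x, y), (D120, x, y), (D0, x, y)).

Definition down_triangle (x y : nat) : lattice_edge * lattice_edge * lattice_edge :=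
  ((D60, x.+1, y), (D120, x, y), (D0, x, y.+1)).

(* A triangle is determined by its edge of direction 120 and its orientation. *)
Definition clockwise_triangle (e1 e2 e3 : lattice_edge) : bool :=
  let: (_, x, y) := e2 in
  (e1, e2, e3) \in [:: up_triangle x y; down_triangle x y].

(* The regular hexagon of side a with corners, clockwise from the west one,   *)
(* (0, a), (0, 2a), (a, 2a), (2a, a), (2a, 0), (a, 0).                        *)
Definition in_hexagon (a : nat) (p : point) : bool :=
  [&& p.1 <= 2 * a, p.2 <= 2 * a, a <= p.1 + p.2 & p.1 + p.2 <= 3 * a].

Definition hexagon_edges (a : nat) : seq lattice_edge :=
  [seq e <- [seq (q.1, q.2, y) | q <- [seq (d, x) | d <- [:: D0; D60; D120],
                                                    x <- iota 0 (2 * a).+1],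
                                 y <- iota 0 (2 * a).+1]
   | all (in_hexagon a) (endpoints e)].

(* The i-th edge (0 <= i < a) of each side of the hexagon, read clockwise.    *)
Definition side_SW (a i : nat) : lattice_edge := (D120, a - i.+1, i).
Definition side_NW (a i : nat) : lattice_edge := (D60, 0, a + i).
Definition side_N  (a i : nat) : lattice_edge := (D0, i, 2 * a).
Definition side_NE (a i : nat) : lattice_edge := (D120, a + i, 2 * a - i.+1).
Definition side_SE (a i : nat) : lattice_edge := (D60, 2 * a, a - i.+1).
Definition side_S  (a i : nat) : lattice_edge := (D0, 2 * a - i.+1, 0).

Notation labeling a := {ffun seq_sub (hexagon_edges a) -> label}.

Definition agrees_on (a : nat) (side : nat -> lattice_edge) (s : a.-tuple bool)
    (p : labeling a) : bool :=
  [forall e, forall i : 'I_a,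
     (val e == side i) ==> (p e == label_of_bit (tnth s i))].

(* All three edges of a unit triangle lie in the hexagon exactly when the     *)
(* triangle does, by convexity.                                               *)
Definition all_pieces_allowed (a : nat) (p : labeling a) : bool :=
  [forall e1, forall e2, forall e3,
     clockwise_triangle (val e1) (val e2) (val e3)
       ==> allowed_piece (p e1, p e2, p e3)].

Definition hexagonal_puzzles (a : nat)
    (alpha beta gamma delta epsilon zeta : a.-tuple bool) : {set labeling a} :=
  [set p : labeling a |
    [&& agrees_on (side_SW a) alpha p,
        agrees_on (side_NW a) beta p,
        agrees_on (side_N a) gamma p,
        agrees_on (side_NE a) delta p,
        agrees_on (side_SE a) epsilon p,
        agrees_on (side_S a) zeta p
      & all_pieces_allowed p]].

Definition Hex (a : nat)
    (alpha beta gamma delta epsilon zeta : a.-tuple bool) : nat :=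
  #|hexagonal_puzzles alpha beta gamma delta epsilon zeta|.

(* Main.v *)
Require Import Defs.
From mathcomp Require Import all_boot ssralg ssrint zify ring.

(* Give each directed edge a holonomy in a Heisenberg group: its displacement *)
(* is split into a 0-part and a 1-part, and the central coordinate pairs      *)
(* 0-parts with later 1-parts by a form, invariant under rotations by 60      *)
(* degrees, that vanishes on the sides of the rhombi. Every allowed piece     *)
(* then has trivial holonomy, hence so does the boundary, and comparing       *)
(* central coordinates shows that the pairs of a 0 followed by a 1 on the six *)
(* sides number 6 a0 a1 in total. This is their maximum, so each side is      *)
(* sorted.                                                                    *)
(* When all sides are sorted, the six spokes joining the corners of the       *)
(* outer side of the outermost ring of triangles to its inner corners are     *)
(* equally labeled, 0 or 1; the choice forces the whole ring and leaves a     *)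
(* hexagon with sorted sides having one 0, respectively one 1, less. Puzzles  *)
(* thus correspond to words of length a with a1 ones, read outwards.          *)

Set Implicit Arguments.
Unset Strict Implicit.
Unset Printing Implicit Defensive.

(** * Holonomy *)

(** The vanishing is an extremal argument. [loop_hol] contracts the boundary loop ring by ring to
    the center, so its central coordinate is 0. In [boundary_sorted] this coordinate is the sum of
    the six numbers [coinv], minus 6 a0 a1, while [coinv_le] bounds each of them by a0 a1. Hence all
    six bounds are attained, and by [coinv_max] only sorted strings attain them.

    For sorted sides, [ring_cases], [strip_ones] and [strip_zeros] show that one binary letter per
    ring determines the ring and leaves sorted sides inside, so a puzzle is recovered from its
    spokes ([sorted_puzzle_labels]). Conversely [word_label] turns every word into a labeling with
    allowed pieces. The combinatorics takes place in a model of the hexagon as six sectors cut into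
    rings, [sector_puzzle]; [pieces_allowed_sectors] and [sectors_pieces_allowed] relate it to the
    lattice. *)

Lemma allowed_pieceP (x y z : label) :
  allowed_piece (x, y, z) ->
  [\/ (x, y, z) = (L0, L0, L0), (x, y, z) = (L1, L1, L1)
    | [\/ (x, y, z) = (L1, L0, L10), (x, y, z) = (L0, L10, L1)
        | (x, y, z) = (L10, L1, L0)]].
Proof.
by case: x; case: y; case: z => //= _;
  first [by constructor 1 | by constructor 2 | constructor 3;
         first [by constructor 1 | by constructor 2 | by constructor 3]].
Qed.

Lemma allowed_piece_rot (x y z : label) :
  allowed_piece (x, y, z) = allowed_piece (y, z, x).
Proof. by case: x; case: y; case: z. Qed.

(* A tuple [(x, y, t)] with [x], [y] in Z[zeta], zeta a primitive 6th root of *)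
(* unity, each given by two coordinates on the basis (1, zeta).               *)
Definition hol : Type := (int * int * int * int * int)%type.

Definition hone : hol := (0%Z, 0%Z, 0%Z, 0%Z, 0%Z).

(* The cocycle is the coefficient of [1] in [conj x * y'] on (1, zeta); it    *)
(* vanishes on the pairs of sides [u], [zeta * u] of a 0/1-rhombus.           *)
Definition hmul (x y : hol) : hol :=
  let: (x1, x2, x3, x4, t) := x in
  let: (y1, y2, y3, y4, t') := y in
  (x1 + y1, x2 + y2, x3 + y3, x4 + y4, t + t' + ((x1 + x2) * y3 + x2 * y4))%R.

Lemma hmulA : associative hmul.
Proof.
move=> [[[[? ?] ?] ?] ?] [[[[? ?] ?] ?] ?] [[[[? ?] ?] ?] ?] /=.
by congr (_, _, _, _, _); ring.
Qed.

Lemma hmul1x : left_id hone hmul.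
Proof. by move=> [[[[? ?] ?] ?] ?] /=; congr (_, _, _, _, _); ring. Qed.

Lemma hmulx1 : right_id hone hmul.
Proof. by move=> [[[[? ?] ?] ?] ?] /=; congr (_, _, _, _, _); ring. Qed.

Lemma hmul_id (x y : hol) : hmul x y = y -> x = hone.
Proof.
move: x y => [[[[x1 x2] x3] x4] t] [[[[y1 y2] y3] y4] t'] /= [e1 e2 e3 e4].
have -> : x1 = 0%R by lia.
have -> : x2 = 0%R by lia.
have -> : x3 = 0%R by lia.
have -> : x4 = 0%R by lia.
by move=> e; congr (_, _, _, _, _); lia.
Qed.

Definition unit_dir (k : nat) : int * int :=
  nth (1, 0)%R [:: (1, 0); (0, 1); (-1, 1); (-1, 0); (0, -1); (1, -1)]%R (k %% 6).

(* Multiplication by zeta is the clockwise rotation by 60 degrees, and        *)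
(* [zeta ^+ s] is the clockwise direction of the [s]-th side of the hexagon.  *)
(* A 10-edge is the diagonal of a rhombus: it has the displacements of the    *)
(* two sides of that rhombus.                                                 *)
Definition edge_hol (k : nat) (l : label) : hol :=
  match l with
  | L0 => let: (m, n) := unit_dir k in (m, n, 0, 0, 0)%R
  | L1 => let: (m, n) := unit_dir k in (0, 0, m, n, 0)%R
  | L10 => let: (m, n) := unit_dir k.+1 in
           let: (m', n') := unit_dir (k + 5) in (m, n, m', n', 0)%R
  end.

(** With the sector turned to the top, the outer edge followed by the right edge, and the left edge
    alone, are two paths from the upper left corner to the apex; [s.+2] and [s.+1] are the
    directions of the right and left edges traversed inwards. *)
Lemma edge_hol_outward (s : nat) (x y z : label) : s < 6 ->
  allowed_piece (x, y, z) ->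
  hmul (edge_hol s x) (edge_hol s.+2 y) = edge_hol s.+1 z.
Proof.
move=> hs /allowed_pieceP H.
case: s hs => [|[|[|[|[|[|//]]]]]] _;
by move: H => [[-> -> ->]|[-> -> ->]|[[-> -> ->]|[-> -> ->]|[-> -> ->]]].
Qed.

Lemma edge_hol_inward (s : nat) (x y z : label) : s < 6 ->
  allowed_piece (x, y, z) ->
  hmul (edge_hol s.+2 x) (edge_hol s z) = edge_hol s.+1 y.
Proof.
move=> hs /allowed_pieceP H.
case: s hs => [|[|[|[|[|[|//]]]]]] _;
by move: H => [[-> -> ->]|[-> -> ->]|[[-> -> ->]|[-> -> ->]|[-> -> ->]]].
Qed.

(* Arguments: sector, ring, position along the ring. *)
Definition sector_labeling : Type := nat -> nat -> nat -> label.

(** [O], [A], [B] label the outer, left and right edges. The clauses concern the triangles with an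
    edge on the outer side of a ring, those with an edge on its inner side, and the spokes shared by
    consecutive sectors. *)
Definition sector_puzzle (n : nat) (O A B : sector_labeling) : Prop :=
  [/\ forall s r i, s < 6 -> r < n -> i <= r ->
        allowed_piece (O s r i, B s r i, A s r i),
      forall s r i, s < 6 -> r.+1 < n -> i <= r ->
        allowed_piece (B s r.+1 i, A s r.+1 i.+1, O s r i)
    & forall s r, s < 6 -> r < n -> B s r r = A (s.+1 %% 6) r 0].

Fixpoint hpath (f : nat -> hol) (n : nat) : hol :=
  if n is m.+1 then hmul (hpath f m) (f m) else hone.

Lemma hpathS (f : nat -> hol) (n : nat) : hpath f n.+1 = hmul (hpath f n) (f n).
Proof. by []. Qed.

Lemma eq_hpath (f g : nat -> hol) (n : nat) :
  (forall i, i < n -> f i = g i) -> hpath f n = hpath g n.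
Proof.
by elim: n => //= n IH H; rewrite H // IH // => i hi; apply: H; apply: ltnW.
Qed.

Lemma hpath_telescope (f g h : nat -> hol) (n : nat) :
  (forall k, k < n -> hmul (f k) (h k.+1) = hmul (h k) (g k)) ->
  hmul (hpath f n) (h n) = hmul (h 0) (hpath g n).
Proof.
elim: n => [_|n IH H]; first by rewrite hmul1x hmulx1.
rewrite !hpathS -hmulA H // !hmulA IH //.
by move=> k hk; apply: H; apply: ltnW.
Qed.

Definition side_hol (O : sector_labeling) (n s : nat) : hol :=
  hpath (fun i => edge_hol s (O s n.-1 i)) n.

Lemma strip_hol (n : nat) (O A B : sector_labeling) (s r : nat) :
  sector_puzzle n O A B -> s < 6 -> r < n ->
  hmul (side_hol O r.+1 s) (edge_hol s.+2 (A (s.+1 %% 6) r 0)) =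
  hmul (edge_hol s.+1 (A s r 0)) (side_hol O r s).
Proof.
move=> [outw inw spoke] hs hr; rewrite -spoke // /side_hol.
(* The last outward triangle has no inward partner: it trades the last outer edge and the spoke for
   its left edge. The other triangles pair up into [r] rhombi, which telescope. *)
rewrite hpathS -hmulA.
rewrite (edge_hol_outward hs (outw s r r hs hr (leqnn r))).
apply: (@hpath_telescope _ _ (fun k => edge_hol s.+1 (A s r k))) => k hk.
case: r hr hk => // r hr hk.
rewrite -(edge_hol_inward hs (inw s r k hs hr hk)) hmulA; congr hmul.
by apply: edge_hol_outward => //; apply: outw => //; apply: ltnW.
Qed.

(** Pushing the six sides across a ring conjugates the loop by a spoke, as direction 7 is direction
    1 again; at the center the loop is empty. *)
Lemma loop_hol (n : nat) (O A B : sector_labeling) (r : nat) :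
  sector_puzzle n O A B -> r <= n -> hpath (side_hol O r) 6 = hone.
Proof.
move=> puz; elim: r => [//|r IH] hr.
apply: (@hmul_id _ (edge_hol 1 (A 0 r 0))).
rewrite (@hpath_telescope _ (side_hol O r)
           (fun s => edge_hol s.+1 (A (s %% 6) r 0))).
  by rewrite IH ?hmulx1 // ltnW.
by move=> s hs; rewrite (strip_hol puz) // modn_small.
Qed.

(** * Pairs of a 0 followed by a 1, and sortedness of the boundary *)

Fixpoint zeros (f : nat -> bool) (n : nat) : nat :=
  if n is m.+1 then zeros f m + ~~ f m else 0.

(* The number of pairs [i < j < n] with [f i = 0] and [f j = 1]. *)
Fixpoint coinv (f : nat -> bool) (n : nat) : nat :=
  if n is m.+1 then coinv f m + f m * zeros f m else 0.

Lemma zerosS (f : nat -> bool) (n : nat) : zeros f n.+1 = zeros f n + ~~ f n.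
Proof. by []. Qed.

Lemma zeros_le (f : nat -> bool) (n : nat) : zeros f n <= n.
Proof. by elim: n => //= n; case: (f n) => /=; lia. Qed.

Lemma coinv_le (f : nat -> bool) (n : nat) :
  coinv f n <= zeros f n * (n - zeros f n).
Proof.
elim: n => //= n; have := zeros_le f n; case: (f n) => /=; nia.
Qed.

(** A last 1 raises the count and the bound equally; a last 0 raises only the bound, by the number
    of earlier 1s. Equality thus forbids a 0 after a 1. *)
Lemma coinv_max (f : nat -> bool) (n : nat) :
  coinv f n = zeros f n * (n - zeros f n) ->
  forall i, i < n -> f i = (zeros f n <= i).
Proof.
elim: n => //= n IH; have zn := zeros_le f n; have cn := coinv_le f n.
case Efn: (f n) => /=.
- move=> e i; rewrite ltnS leq_eqVlt => /orP[/eqP->|hi]; first by rewrite Efn; lia.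
  by rewrite IH //; nia.
- move=> e i hin.
  have z_n : zeros f n = n by nia.
  move: hin; rewrite ltnS leq_eqVlt => /orP[/eqP->|hi]; first by rewrite Efn; lia.
  by rewrite IH //; nia.
Qed.

(** The form is 1 on two equal unit vectors, so each 0 followed by a 1 adds 1 to the central
    coordinate. *)
Lemma side_hol_bits (s : nat) (f : nat -> bool) (n : nat) : s < 6 ->
  hpath (fun i => edge_hol s (label_of_bit (f i))) n =
  let: (u, v) := unit_dir s in
  let z := Posz (zeros f n) in
  let o := Posz (n - zeros f n) in
  (z * u, z * v, o * u, o * v, Posz (coinv f n))%R.
Proof.
move=> hs; elim: n => [|n IH].
  by case: s hs => [|[|[|[|[|[|//]]]]]].
rewrite hpathS IH; have := zeros_le f n.
case: s hs {IH} => [|[|[|[|[|[|//]]]]]] _ zn;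
  rewrite /unit_dir /=; case: (f n) => /=; congr (_, _, _, _, _); nia.
Qed.

Lemma boundary_sorted (n k : nat) (O A B : sector_labeling)
    (f : nat -> nat -> bool) :
  sector_puzzle n O A B ->
  (forall s i, s < 6 -> i < n -> O s n.-1 i = label_of_bit (f s i)) ->
  (forall s, s < 6 -> zeros (f s) n = k) ->
  forall s i, s < 6 -> i < n -> f s i = (k <= i).
Proof.
move=> puz Of fk; have := loop_hol puz (leqnn n).
have sideE s : s < 6 -> side_hol O n s =
    let: (u, v) := unit_dir s in
    (Posz k * u, Posz k * v, Posz (n - k) * u, Posz (n - k) * v, Posz (coinv (f s) n))%R.
  move=> hs; rewrite -(fk s hs) -(side_hol_bits (f s) n hs) /side_hol.
  by apply: eq_hpath => i hi; rewrite Of.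
move=> e.
(* Two sides at distance d contribute k(n-k) times the coefficient of 1 in zeta^d, which is 0, -1,
   -1, 0, 1 for d = 1, ..., 5. There are 6-d such pairs, so the cross terms sum to -6k(n-k). *)
have {e} sum6 : coinv (f 0) n + coinv (f 1) n + coinv (f 2) n + coinv (f 3) n
    + coinv (f 4) n + coinv (f 5) n = 6 * (k * (n - k)).
  move: e; rewrite !hpathS !sideE // /unit_dir /= => -[_ _ _ _].
  by lia.
have le_co s : s < 6 -> coinv (f s) n <= k * (n - k).
  by move=> hs; rewrite -(fk s hs); apply: coinv_le.
have eq_co s : s < 6 -> coinv (f s) n = k * (n - k).
  move: (le_co 0 isT) (le_co 1 isT) (le_co 2 isT) (le_co 3 isT) (le_co 4 isT)
    (le_co 5 isT); case: s => [|[|[|[|[|[|//]]]]]] *; lia.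
by move=> s i hs hi; rewrite -(fk s hs); apply: (@coinv_max _ n); rewrite // fk ?eq_co.
Qed.

(** * Rings with sorted outer sides *)

(** The strip is filled from left to right, every label being forced; the inner side loses a 1. *)
Lemma strip_ones (n : nat) (O A B : sector_labeling) (s r k : nat) :
  sector_puzzle n O A B -> s < 6 -> r < n ->
  (forall i, i <= r -> O s r i = label_of_bit (k <= i)) -> A s r 0 = L1 ->
  forall i, i <= r ->
  [/\ A s r i = L1, B s r i = (if i < k then L10 else L1)
    & i < r -> O s r.-1 i = label_of_bit (k <= i)].
Proof.
move=> [outw inw _] hs hr Oeq A0.
have right_of i : i <= r -> A s r i = L1 -> B s r i = if i < k then L10 else L1.
  move=> hi Ai; move: (outw s r i hs hr hi); rewrite Oeq // Ai.
  by case: (leqP k i); case: (B s r i).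
have next i : i < r -> A s r i = L1 ->
    A s r i.+1 = L1 /\ O s r.-1 i = label_of_bit (k <= i).
  case: r hr Oeq {A0} right_of => // r hr Oeq right_of hi Ai.
  move: (inw s r i hs hr hi) (outw s r.+1 i.+1 hs hr hi).
  rewrite (right_of i (ltnW hi) Ai) Oeq //=.
  (* For [k <= i] the inward triangle alone could be (1, 0, 10); the next outward triangle, whose
     outer label is again 1, excludes a left label 0. *)
  case: (leqP k i) => ki.
    by rewrite (leqW ki); case: (A s _ _); case: (B s _ _); case: (O s _ _).
  by case: (A s _ _); case: (O s _ _).
have left_all i : i <= r -> A s r i = L1.
  by elim: i => // i IH hi; case: (next i hi (IH (ltnW hi))).
move=> i hi; split; [exact: left_all | exact/right_of/left_all | ].
by move=> hir; case: (next i hir (left_all i hi)).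
Qed.

(** Now the inner side loses a 0. The inward triangle is (0, 0, 0) or (0, 10, 1), and the next outer
    label decides: a 0 excludes the left label 10, a 1 excludes the left label 0. *)
Lemma strip_zeros (n : nat) (O A B : sector_labeling) (s r k : nat) :
  sector_puzzle n O A B -> s < 6 -> r < n -> 0 < k ->
  (forall i, i <= r -> O s r i = label_of_bit (k <= i)) -> A s r 0 = L0 ->
  forall i, i <= r ->
  [/\ A s r i = (if i < k then L0 else L10), B s r i = L0
    & i < r -> O s r.-1 i = label_of_bit (k.-1 <= i)].
Proof.
move=> [outw inw _] hs hr k_gt0 Oeq A0.
have right_of i : i <= r -> A s r i = (if i < k then L0 else L10) -> B s r i = L0.
  move=> hi Ai; move: (outw s r i hs hr hi); rewrite Oeq // Ai.
  by case: (leqP k i); case: (B s r i).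
have next i : i < r -> A s r i = (if i < k then L0 else L10) ->
    A s r i.+1 = (if i.+1 < k then L0 else L10) /\
    O s r.-1 i = label_of_bit (k.-1 <= i).
  case: r hr Oeq {A0} right_of => // r hr Oeq right_of hi Ai.
  move: (inw s r i hs hr hi) (outw s r.+1 i.+1 hs hr hi).
  rewrite (right_of i (ltnW hi) Ai) Oeq //=.
  case: k k_gt0 {Oeq right_of Ai} => // k _.
  rewrite !ltnS /=.
  by case: (leqP k i) => ki; case: (A s _ _); case: (B s _ _); case: (O s _ _).
have left_all i : i <= r -> A s r i = (if i < k then L0 else L10).
  elim: i => [|i IH hi]; first by rewrite k_gt0.
  by case: (next i hi (IH (ltnW hi))).
move=> i hi; split; [exact: left_all | exact/right_of/left_all | ].
by move=> hir; case: (next i hir (left_all i hi)).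
Qed.

Lemma all_sectors (P : nat -> Prop) :
  P 0 -> (forall s, s < 6 -> P s -> P (s.+1 %% 6)) -> forall s, s < 6 -> P s.
Proof.
move=> P0 PS; elim=> // s IH hs.
by have := PS s (ltnW hs) (IH (ltnW hs)); rewrite modn_small.
Qed.

Lemma ring_cases (n : nat) (O A B : sector_labeling) (r k : nat) :
  sector_puzzle n O A B -> r < n ->
  (forall s i, s < 6 -> i <= r -> O s r i = label_of_bit (k <= i)) ->
  (A 0 r 0 = L1 /\ k <= r /\ forall s, s < 6 -> A s r 0 = L1) \/
  (A 0 r 0 = L0 /\ 0 < k /\ forall s, s < 6 -> A s r 0 = L0).
Proof.
move=> puz hr Oeq; have [outw inw spoke] := puz.
have A0 : A 0 r 0 = L1 \/ A 0 r 0 = L0 /\ 0 < k.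
  (* The first triangle of sector 0 settles [0 < k]. For [k = 0] it leaves 1 or 10, and the last
     triangle of sector 5, across the same spoke, excludes 10. *)
  move: (outw 5 r r isT hr (leqnn r)) (outw 0 r 0 isT hr (leq0n r)).
  rewrite !Oeq // (spoke 5) // leqn0 modnn.
  case: k {Oeq} => [|k] /=; last by case: (A 0 r 0); case: (B 0 r 0) => //; auto.
  by case: (A 0 r 0); case: (A 5 r r); case: (B 0 r 0) => //; auto.
have [a1|[a0 k_gt0]] := A0; [left | right]; last first.
- split=> //; split=> //; apply: all_sectors => // s hs As.
  have [] := strip_zeros puz hs hr k_gt0 (fun i => @Oeq s i hs) As (leqnn r).
  by rewrite spoke.
(* Without a 1 on the outer side the strip would end in a spoke 10, which cannot be the left edge of
   a triangle with outer label 0. *)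
- have spoke_next s : s < 6 -> A s r 0 = L1 -> k <= r /\ A (s.+1 %% 6) r 0 = L1.
    move=> hs As; have hs' : s.+1 %% 6 < 6 by rewrite ltn_mod.
    have [_ Brr _] := strip_ones puz hs hr (fun i => @Oeq s i hs) As (leqnn r).
    move: (outw _ r 0 hs' hr (leq0n r)); rewrite Oeq // -spoke // Brr.
    case: (leqP k r) => // rk; rewrite leqn0 gtn_eqF ?(leq_ltn_trans _ rk) //.
    by case: (B _ r 0).
  split=> //; split; first by case: (spoke_next 0).
  by apply: all_sectors => // s hs /(spoke_next s hs)[].
Qed.

(* The letter [b r] is the common label of the six spokes of ring [r].        *)
Definition outer_label (b : nat -> bool) (r i : nat) : label :=
  label_of_bit (zeros b r.+1 <= i).

(** The labels forced by [strip_ones] and [strip_zeros] when the outer side has [zeros b r.+1]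
    zeros. *)
Definition left_label (b : nat -> bool) (r i : nat) : label :=
  if b r then L1 else if i < zeros b r.+1 then L0 else L10.

Definition right_label (b : nat -> bool) (r i : nat) : label :=
  if b r then if i < zeros b r.+1 then L10 else L1 else L0.

Lemma word_labels_allowed_outward (b : nat -> bool) (r i : nat) :
  allowed_piece (outer_label b r i, right_label b r i, left_label b r i).
Proof.
rewrite /outer_label /right_label /left_label.
by case: (b r); case: leqP.
Qed.

Lemma word_labels_allowed_inward (b : nat -> bool) (r i : nat) :
  allowed_piece (right_label b r.+1 i, left_label b r.+1 i.+1, outer_label b r i).
Proof.
rewrite /outer_label /right_label /left_label.
rewrite (zerosS b r.+1).
case: (b r.+1); rewrite ?addn0 ?addn1 ?ltnS; first by case: (ltnP i (zeros b r.+1)).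
by case: leqP.
Qed.

(** [zeros b r.+1] counts the letter [b r] itself: it is positive if that letter is 0, and at most
    [r] if it is 1. *)
Lemma word_labels_spoke (b : nat -> bool) (r : nat) :
  right_label b r r = left_label b r 0.
Proof.
rewrite /right_label /left_label zerosS; have := zeros_le b r.
by case: (b r); rewrite ?addn0 ?addn1 //= ltnNge => ->.
Qed.

Lemma sorted_puzzle_labels (n : nat) (O A B : sector_labeling) (k : nat) :
  sector_puzzle n O A B ->
  k <= n ->
  (forall s i, s < 6 -> i < n -> O s n.-1 i = label_of_bit (k <= i)) ->
  let b := fun r => A 0 r 0 == L1 in
  zeros b n = k /\
  forall s r i, s < 6 -> r < n -> i <= r ->
    [/\ O s r i = outer_label b r i, A s r i = left_label b r i
      & B s r i = right_label b r i].
Proof.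
move=> puz kn Oeq b.
(* Generalized to the inner hexagon of side [m] with [l] zeros on each side: peeling off its
   outermost ring lowers [m] and, if the spokes are 0, also [l]. *)
suff H m : m <= n -> forall l, l <= m ->
    (forall s i, s < 6 -> i < m -> O s m.-1 i = label_of_bit (l <= i)) ->
    zeros b m = l /\ forall s r i, s < 6 -> r < m -> i <= r ->
    [/\ O s r i = outer_label b r i, A s r i = left_label b r i
      & B s r i = right_label b r i] by exact: H.
elim: m {k kn Oeq} => [_|r IH hr] k kn Oeq.
  by split=> [|s r i _]; [case: k kn {Oeq} | rewrite ltn0].
have ring_ok s i : s < 6 -> i <= r -> zeros b r.+1 = k ->
  O s r i = outer_label b r i by move=> hs hi zk; rewrite /outer_label zk Oeq.
have [[a1 [kr A1]]|[a0 [k0 A0]]] := ring_cases puz hr Oeq.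
- have br : b r = true by rewrite /b a1.
  have st s (hs : s < 6) := strip_ones puz hs hr (fun i => @Oeq s i hs) (A1 s hs).
  have [|zr labs] := IH (ltnW hr) k kr.
    move=> s i hs hi; have [_ _] := st s hs i (ltnW hi); exact.
  have zk : zeros b r.+1 = k by rewrite zerosS br zr addn0.
  split=> // s r' i hs; rewrite ltnS leq_eqVlt => /orP[/eqP-> hi|]; last exact: labs.
  have [-> -> _] := st s hs i hi.
  by split; [exact: ring_ok | rewrite /left_label br | rewrite /right_label br zk].
- have br : b r = false by rewrite /b a0.
  have st s (hs : s < 6) := strip_zeros puz hs hr k0 (fun i => @Oeq s i hs) (A0 s hs).
  have [||zr labs] := IH (ltnW hr) k.-1.
  + by rewrite -ltnS prednK.
  + move=> s i hs hi; have [_ _] := st s hs i (ltnW hi); exact.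
  have zk : zeros b r.+1 = k by rewrite zerosS br zr addn1 prednK.
  split=> // s r' i hs; rewrite ltnS leq_eqVlt => /orP[/eqP-> hi|]; last exact: labs.
  have [-> -> _] := st s hs i hi.
  by split; [exact: ring_ok | rewrite /left_label br zk | rewrite /right_label br].
Qed.

(** * Sector coordinates of the hexagon *)

Lemma mem_hexagon_edges (a : nat) (e : lattice_edge) :
  (e \in hexagon_edges a) = all (in_hexagon a) (endpoints e).
Proof.
rewrite mem_filter; case: (boolP (all _ _)) => // hin; rewrite andTb.
case: e hin => [[d x] y] hin.
apply/allpairsPdep; exists (d, x), y; split=> //.
  apply/allpairsPdep; exists d, x; split=> //; first by case: (d).
  by rewrite mem_iota; case: d hin; rewrite /= /in_hexagon /=; lia.
by rewrite mem_iota; case: d hin; rewrite /= /in_hexagon /=; lia.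
Qed.

(* Rings are numbered from the center, ring [r] having outer side [r.+1], and *)
(* sectors clockwise from SW. Turning the hexagon so that the sector is on    *)
(* top, the ring is a strip of triangles; the [i]-th triangle standing on its *)
(* outer side is bounded by [outer_edge], [left_edge] and [right_edge].       *)
Definition outer_edge (a s r i : nat) : lattice_edge :=
  match s with
  | 0 => (D120, a - i.+1, a - r.+1 + i)
  | 1 => (D60, a - r.+1, a + i)
  | 2 => (D0, a - r.+1 + i, a + r.+1)
  | 3 => (D120, a + i, a + r - i)
  | 4 => (D60, a + r.+1, a - i.+1)
  | _ => (D0, a + r - i, a - r.+1)
  end.

Definition left_edge (a s r i : nat) : lattice_edge :=
  match s with
  | 0 => (D60, a - i, a - r.+1 + i)
  | 1 => (D0, a - r.+1, a + i)
  | 2 => (D120, a - r.+1 + i, a + r)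
  | 3 => (D60, a + i, a + r - i)
  | 4 => (D0, a + r, a - i)
  | _ => (D120, a + r - i, a - r.+1)
  end.

Definition right_edge (a s r i : nat) : lattice_edge :=
  match s with
  | 0 => (D0, a - i.+1, a - r + i)
  | 1 => (D120, a - r.+1, a + i)
  | 2 => (D60, a - r + i, a + r)
  | 3 => (D0, a + i, a + r - i)
  | 4 => (D120, a + r, a - i.+1)
  | _ => (D60, a + r - i, a - r.+1)
  end.

Lemma sector_edge_in_hexagon (a s r i : nat) : s < 6 -> r < a -> i <= r ->
  [/\ outer_edge a s r i \in hexagon_edges a,
      left_edge a s r i \in hexagon_edges a
    & right_edge a s r i \in hexagon_edges a].
Proof.
move=> hs hr hi; rewrite !mem_hexagon_edges.
by case: s hs => [|[|[|[|[|[|//]]]]]] _; split; rewrite /= /in_hexagon /=; lia.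
Qed.

Ltac edge_lia :=
  rewrite /outer_edge /left_edge /right_edge; congr (_, _, _); lia.

Ltac in_sector s r i :=
  exists s, r, i; split;
  [ lia | lia | lia
  | first [ by constructor 1; edge_lia
          | by constructor 2; edge_lia | by constructor 3; edge_lia ] ].

(** The lines [x = a], [y = a] and [x + y = 2 * a] through the center separate the sectors, and the
    cases locate the edge relative to them. An edge of direction 120 has endpoints of coordinate sum
    [(x + y).+1]. *)
Lemma sector_edge_exists (a : nat) (e : lattice_edge) : e \in hexagon_edges a ->
  exists s r i, [/\ s < 6, r < a, i <= r
    & [\/ e = outer_edge a s r i, e = left_edge a s r i
        | e = right_edge a s r i]].
Proof.
rewrite mem_hexagon_edges; case: e => [[d x] y].
case: d; rewrite /= /in_hexagon /= => hin.
- have [hy|hy] := leqP a y.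
    have [hx|hx] := leqP a x.
      by have [?|?] := leqP (x + y).+1 (3 * a); [in_sector 3 (x + y - 2 * a) (x - a)|lia].
    have [hxy|hxy] := leqP (2 * a) (x + y).
      by in_sector 2 (y - a.+1) (x + y - 2 * a).
    by in_sector 1 (a - x.+1) (y - a).
  have [hx|hx] := leqP a x.
    have [hxy|hxy] := leqP (2 * a) (x + y).
      by in_sector 4 (x - a) (a - y).
    by in_sector 5 (a - y.+1) (2 * a - x.+1 - y).
  by in_sector 0 (2 * a - x.+1 - y) (a - x.+1).
- have [hy|hy] := leqP a y.
    have [hx|hx] := leqP a x.
      by in_sector 3 (x + y - 2 * a) (x - a).
    have [hxy|hxy] := leqP (2 * a) (x + y).
      by in_sector 2 (y - a) (x + y - 2 * a).
    by in_sector 1 (a - x.+1) (y - a).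
  have [hx|hx] := leqP x a.
    by in_sector 0 (2 * a - x.+1 - y) (a - x).
  have [hxy|hxy] := leqP (2 * a) (x + y).
    by in_sector 4 (x - a.+1) (a - y.+1).
  by in_sector 5 (a - y.+1) (2 * a - x.+1 - y).
- have [hy|hy] := leqP a y.
    have [hx|hx] := leqP a x.
      by in_sector 3 (x + y - 2 * a) (x - a).
    have [hxy|hxy] := leqP (2 * a) (x + y).+1.
      by in_sector 2 (y - a) ((x + y).+1 - 2 * a).
    by in_sector 1 (a - x.+1) (y - a).
  have [hx|hx] := leqP a x.
    have [hxy|hxy] := leqP (2 * a) (x + y).+1.
      by in_sector 4 (x - a) (a - y.+1).
    by in_sector 5 (a - y.+1) (2 * a - x.+1 - y).
  by in_sector 0 (2 * a - x.+2 - y) (a - x.+1).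
Qed.

(** Here [f] is defined on all lattice edges, which avoids membership proofs; the bounds say that
    the triangle lies in the hexagon. *)
Definition pieces_allowed (a : nat) (f : lattice_edge -> label) : Prop :=
  (forall x y, x < 2 * a -> y < 2 * a -> a <= x + y -> x + y < 3 * a ->
     allowed_piece (f (D60, x, y), f (D120, x, y), f (D0, x, y))) /\
  (forall x y, x < 2 * a -> y < 2 * a -> a <= (x + y).+1 -> (x + y).+1 < 3 * a ->
     allowed_piece (f (D60, x.+1, y), f (D120, x, y), f (D0, x, y.+1))).

Lemma all_pieces_allowedP (a : nat) (p : labeling a) (f : lattice_edge -> label) :
  (forall e, p e = f (val e)) ->
  reflect (pieces_allowed a f) (all_pieces_allowed p).
Proof.
move=> pf; apply: (iffP idP).
- move=> pieces.
  have ok e1 e2 e3 : e1 \in hexagon_edges a -> e2 \in hexagon_edges a ->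
      e3 \in hexagon_edges a -> clockwise_triangle e1 e2 e3 ->
      allowed_piece (f e1, f e2, f e3).
    move=> h1 h2 h3 cw.
    move/forallP: pieces => /(_ (SeqSub h1)) /forallP /(_ (SeqSub h2)).
    by move=> /forallP /(_ (SeqSub h3)) /implyP; rewrite !pf; apply.
  by split=> x y *; apply: ok;
    rewrite ?mem_hexagon_edges /= /in_hexagon ?inE ?eqxx ?orbT //=; lia.
- move=> [up dn]; apply/forallP => e1; apply/forallP => e2; apply/forallP => e3.
  apply/implyP; rewrite !pf.
  have := valP e1; have := valP e2; have := valP e3.
  case: (val e2) (val e1) (val e3) => [[d x] y] {}e1 {}e3.
  rewrite !mem_hexagon_edges /clockwise_triangle !inE.
  move=> h3 h2 h1 /orP[] /eqP[E1 Ed E3]; move: h1 h2 h3;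
    rewrite {}E1 {}Ed {}E3 /= /in_hexagon /= => h1 h2 h3; [apply: up | apply: dn]; lia.
Qed.

Lemma allowed_piece_edges (f : lattice_edge -> label)
    (e1 e2 e3 e1' e2' e3' : lattice_edge) :
  allowed_piece (f e1, f e2, f e3) -> e1' = e1 -> e2' = e2 -> e3' = e3 ->
  allowed_piece (f e1', f e2', f e3').
Proof. by move=> H -> -> ->. Qed.

(** Consecutive sectors differ by a turn of 60 degrees, so outward triangles point down in even
    sectors and up in odd ones, inward triangles the other way. The rotations of the piece put its
    edges in sector order. *)
Lemma pieces_allowed_sectors (a : nat) (f : lattice_edge -> label) :
  pieces_allowed a f ->
  sector_puzzle a (fun s r i => f (outer_edge a s r i))
    (fun s r i => f (left_edge a s r i)) (fun s r i => f (right_edge a s r i)).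
Proof.
move=> [up dn]; split=> [s r i hs hr hi|s r i hs hr hi|s r hs hr].
- case: s hs => [|[|[|[|[|[|//]]]]]] _.
  + rewrite allowed_piece_rot allowed_piece_rot.
    by apply: allowed_piece_edges (dn (a - i.+1) (a - r.+1 + i) _ _ _ _) _ _ _;
      try edge_lia; lia.
  + by apply: allowed_piece_edges (up (a - r.+1) (a + i) _ _ _ _) _ _ _;
      try edge_lia; lia.
  + rewrite allowed_piece_rot.
    by apply: allowed_piece_edges (dn (a - r.+1 + i) (a + r) _ _ _ _) _ _ _;
      try edge_lia; lia.
  + rewrite allowed_piece_rot allowed_piece_rot.
    by apply: allowed_piece_edges (up (a + i) (a + r - i) _ _ _ _) _ _ _;
      try edge_lia; lia.
  + by apply: allowed_piece_edges (dn (a + r) (a - i.+1) _ _ _ _) _ _ _;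
      try edge_lia; lia.
  + rewrite allowed_piece_rot.
    by apply: allowed_piece_edges (up (a + r - i) (a - r.+1) _ _ _ _) _ _ _;
      try edge_lia; lia.
- case: s hs => [|[|[|[|[|[|//]]]]]] _.
  + rewrite allowed_piece_rot.
    by apply: allowed_piece_edges (up (a - i.+1) (a - r.+1 + i) _ _ _ _) _ _ _;
      try edge_lia; lia.
  + rewrite allowed_piece_rot allowed_piece_rot.
    by apply: allowed_piece_edges (dn (a - r.+2) (a + i) _ _ _ _) _ _ _;
      try edge_lia; lia.
  + by apply: allowed_piece_edges (up (a - r.+1 + i) (a + r.+1) _ _ _ _) _ _ _;
      try edge_lia; lia.
  + rewrite allowed_piece_rot.
    by apply: allowed_piece_edges (dn (a + i) (a + r - i) _ _ _ _) _ _ _;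
      try edge_lia; lia.
  + rewrite allowed_piece_rot allowed_piece_rot.
    by apply: allowed_piece_edges (up (a + r.+1) (a - i.+1) _ _ _ _) _ _ _;
      try edge_lia; lia.
  + by apply: allowed_piece_edges (dn (a + r - i) (a - r.+2) _ _ _ _) _ _ _;
      try edge_lia; lia.
- by case: s hs => [|[|[|[|[|[|//]]]]]] _; congr (f _);
    rewrite ?modnn ?modn_small // /left_edge /right_edge; congr (_, _, _); lia.
Qed.

Lemma sectors_pieces_allowed (a : nat) (f : lattice_edge -> label) :
  sector_puzzle a (fun s r i => f (outer_edge a s r i))
    (fun s r i => f (left_edge a s r i)) (fun s r i => f (right_edge a s r i)) ->
  pieces_allowed a f.
Proof.
move=> [outw inw _]; split=> x y hx hy hl hu.
- have [ay|ya] := leqP a y; have [ax|xa] := leqP a x.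
  + rewrite allowed_piece_rot.
    by apply: allowed_piece_edges (outw 3 (x + y - 2 * a) (x - a) _ _ _) _ _ _;
      try edge_lia; lia.
  + have [?|?] := leqP (2 * a) (x + y).
      by apply: allowed_piece_edges (inw 2 (y - a.+1) (x + y - 2 * a) _ _ _) _ _ _;
        try edge_lia; lia.
    by apply: allowed_piece_edges (outw 1 (a - x.+1) (y - a) _ _ _) _ _ _;
      try edge_lia; lia.
  + have [?|?] := leqP (2 * a) (x + y).
      rewrite allowed_piece_rot.
      by apply: allowed_piece_edges (inw 4 (x - a.+1) (a - y.+1) _ _ _) _ _ _;
        try edge_lia; lia.
    rewrite allowed_piece_rot allowed_piece_rot.
    by apply: allowed_piece_edges (outw 5 (a - y.+1) (2 * a - x.+1 - y) _ _ _) _ _ _;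
      try edge_lia; lia.
  + rewrite allowed_piece_rot allowed_piece_rot.
    by apply: allowed_piece_edges (inw 0 (2 * a - x.+2 - y) (a - x.+1) _ _ _) _ _ _;
      try edge_lia; lia.
- have [ay|ya] := leqP a y; have [ax|xa] := leqP a x.
  + rewrite allowed_piece_rot allowed_piece_rot.
    by apply: allowed_piece_edges (inw 3 (x + y - 2 * a) (x - a) _ _ _) _ _ _;
      try edge_lia; lia.
  + have [?|?] := leqP (2 * a) (x + y).+1.
      rewrite allowed_piece_rot allowed_piece_rot.
      by apply: allowed_piece_edges
        (outw 2 (y - a) ((x + y).+1 - 2 * a) _ _ _) _ _ _;
        try edge_lia; lia.
    rewrite allowed_piece_rot.
    by apply: allowed_piece_edges (inw 1 (a - x.+2) (y - a) _ _ _) _ _ _;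
      try edge_lia; lia.
  + have [?|?] := leqP (2 * a) (x + y).+1.
      by apply: allowed_piece_edges (outw 4 (x - a) (a - y.+1) _ _ _) _ _ _;
        try edge_lia; lia.
    by apply: allowed_piece_edges
      (inw 5 (a - y.+2) (2 * a - x.+2 - y) _ _ _) _ _ _;
      try edge_lia; lia.
  + rewrite allowed_piece_rot.
    by apply: allowed_piece_edges (outw 0 (2 * a - x.+2 - y) (a - x.+1) _ _ _) _ _ _;
      try edge_lia; lia.
Qed.

(** * The labeling of the hexagon given by a word *)

(** Inverts the sector coordinates along the case tree of [sector_edge_exists]; a spoke lies in two
    sectors and is read in one of them. *)
Definition word_label (a : nat) (b : nat -> bool) (e : lattice_edge) : label :=
  let: (d, x, y) := e in
  match d with
  | D0 =>
      if a <= y then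
        if a <= x then right_label b (x + y - 2 * a) (x - a)
        else if 2 * a <= x + y then outer_label b (y - a.+1) (x + y - 2 * a)
        else left_label b (a - x.+1) (y - a)
      else if a <= x then
        if 2 * a <= x + y then left_label b (x - a) (a - y)
        else outer_label b (a - y.+1) (2 * a - x.+1 - y)
      else right_label b (2 * a - x.+1 - y) (a - x.+1)
  | D60 =>
      if a <= y then
        if a <= x then left_label b (x + y - 2 * a) (x - a)
        else if 2 * a <= x + y then right_label b (y - a) (x + y - 2 * a)
        else outer_label b (a - x.+1) (y - a)
      else if a < x then
        if 2 * a <= x + y then outer_label b (x - a.+1) (a - y.+1)
        else right_label b (a - y.+1) (2 * a - x.+1 - y)
      else left_label b (2 * a - x.+1 - y) (a - x)
  | D120 =>
      if a <= y then
        if a <= x then outer_label b (x + y - 2 * a) (x - a)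
        else if 2 * a <= (x + y).+1 then left_label b (y - a) ((x + y).+1 - 2 * a)
        else right_label b (a - x.+1) (y - a)
      else if a <= x then
        if 2 * a <= (x + y).+1 then right_label b (x - a) (a - y.+1)
        else left_label b (a - y.+1) (2 * a - x.+1 - y)
      else outer_label b (2 * a - x.+2 - y) (a - x.+1)
  end.

Lemma word_label_sector (a : nat) (b : nat -> bool) (s r i : nat) :
  s < 6 -> r < a -> i <= r ->
  [/\ word_label a b (outer_edge a s r i) = outer_label b r i,
      word_label a b (left_edge a s r i) = left_label b r i
    & word_label a b (right_edge a s r i) = right_label b r i].
Proof.
move=> hs hr hi.
case: s hs => [|[|[|[|[|[|//]]]]]] _; split;
  rewrite /word_label /outer_edge /left_edge /right_edge;
  repeat case: leqP => ?;
  (* The last two alternatives treat spokes that [word_label] reads in the neighboring sector. *)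
  first [ by congr (outer_label _ _ _); lia
        | by congr (left_label _ _ _); lia
        | by congr (right_label _ _ _); lia
        | by exfalso; lia
        | by (have -> : i = r by lia);
             rewrite word_labels_spoke; congr (left_label _ _ _); lia
        | by (have -> : i = 0 by lia);
             rewrite -word_labels_spoke; congr (right_label _ _ _); lia ].
Qed.

Lemma word_label_pieces_allowed (a : nat) (b : nat -> bool) :
  pieces_allowed a (word_label a b).
Proof.
apply: sectors_pieces_allowed; split=> [s r i hs hr hi|s r i hs hr hi|s r hs hr].
- have [-> -> ->] := word_label_sector b hs hr hi.
  exact: word_labels_allowed_outward.
- have [-> _ _] := word_label_sector b hs (ltnW hr) hi.
  have [_ _ ->] := word_label_sector b hs hr (leqW hi).
  have [_ -> _] := word_label_sector b hs hr (hi : i.+1 <= r.+1).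
  exact: word_labels_allowed_inward.
- have [_ _ ->] := word_label_sector b hs hr (leqnn r).
  have [_ -> _] := word_label_sector b (ltn_pmod s.+1 (isT : 0 < 6)) hr (leq0n r).
  exact: word_labels_spoke.
Qed.

(** * Puzzles as functions on lattice edges *)

Definition edge_label (a : nat) (p : labeling a) (e : lattice_edge) : label :=
  oapp p L0 (insub e).

Lemma edge_labelE (a : nat) (p : labeling a) (e : seq_sub (hexagon_edges a)) :
  p e = edge_label p (val e).
Proof. by rewrite /edge_label valK. Qed.

Lemma agrees_onP (a : nat) (side : nat -> lattice_edge) (s : a.-tuple bool)
    (p : labeling a) (f : lattice_edge -> label) :
  (forall e, p e = f (val e)) ->
  (forall i, i < a -> side i \in hexagon_edges a) ->
  reflect (forall i, i < a -> f (side i) = label_of_bit (nth false s i))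
    (agrees_on side s p).
Proof.
move=> pf hside; apply: (iffP idP) => H.
- move=> i hi; move/forallP: H => /(_ (SeqSub (hside i hi))).
  by move=> /forallP /(_ (Ordinal hi)); rewrite /= eqxx pf (tnth_nth false) => /eqP.
- apply/forallP => e; apply/forallP => i; apply/implyP => /eqP ei.
  by rewrite pf ei H // (tnth_nth false).
Qed.

Lemma side_edges (a i : nat) : i < a ->
  [/\ side_SW a i = outer_edge a 0 a.-1 i, side_NW a i = outer_edge a 1 a.-1 i,
      side_N a i = outer_edge a 2 a.-1 i
    & [/\ side_NE a i = outer_edge a 3 a.-1 i, side_SE a i = outer_edge a 4 a.-1 i
        & side_S a i = outer_edge a 5 a.-1 i]].
Proof. by move=> hi; do 2?[split]; edge_lia. Qed.

(** Stated for any [f] extending [p], to serve both for [edge_label] of a given puzzle and for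
    [word_label]. *)
Lemma hexagonal_puzzlesP (a : nat) (alpha beta gamma delta epsilon zeta : a.-tuple bool)
    (p : labeling a) (f : lattice_edge -> label) :
  (forall e, p e = f (val e)) ->
  let sides := [:: alpha; beta; gamma; delta; epsilon; zeta] in
  reflect (pieces_allowed a f /\
      forall s i, s < 6 -> i < a ->
        f (outer_edge a s a.-1 i) = label_of_bit (nth false (nth alpha sides s) i))
    (p \in hexagonal_puzzles alpha beta gamma delta epsilon zeta).
Proof.
move=> pf sides.
have outer_in s i : s < 6 -> i < a -> outer_edge a s a.-1 i \in hexagon_edges a.
  by move=> hs hi; case: (@sector_edge_in_hexagon a s a.-1 i) => //; lia.
have sideP (side : nat -> lattice_edge) (w : a.-tuple bool) s : s < 6 ->
    (forall i, i < a -> side i = outer_edge a s a.-1 i) ->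
    reflect (forall i, i < a ->
        f (outer_edge a s a.-1 i) = label_of_bit (nth false w i))
      (agrees_on side w p).
  move=> hs sideE; apply: (iffP (agrees_onP _ pf _)) => [i hi|H i hi|H i hi].
  - by rewrite sideE // outer_in.
  - by rewrite -sideE // H.
  - by rewrite sideE // H.
have SW := sideP (side_SW a) alpha 0 isT (fun i hi => let: And4 E _ _ _ := side_edges hi in E).
have NW := sideP (side_NW a) beta 1 isT (fun i hi => let: And4 _ E _ _ := side_edges hi in E).
have NN := sideP (side_N a) gamma 2 isT (fun i hi => let: And4 _ _ E _ := side_edges hi in E).
have NE := sideP (side_NE a) delta 3 isT
  (fun i hi => let: And4 _ _ _ (And3 E _ _) := side_edges hi in E).
have SE := sideP (side_SE a) epsilon 4 isT
  (fun i hi => let: And4 _ _ _ (And3 _ E _) := side_edges hi in E).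
have SS := sideP (side_S a) zeta 5 isT
  (fun i hi => let: And4 _ _ _ (And3 _ _ E) := side_edges hi in E).
rewrite inE; apply: (iffP idP).
- move=> /and5P[/SW h0 /NW h1 /NN h2 /NE h3 /and3P[/SE h4 /SS h5 pieces]].
  split; first exact/(all_pieces_allowedP pf).
  by case=> [|[|[|[|[|[|//]]]]]] i _; [exact: h0|exact: h1|exact: h2|exact: h3|exact: h4|exact: h5].
- move=> [pieces bd]; apply/and5P; split; last apply/and3P; try split.
  + by apply/SW => i; apply: (bd 0).
  + by apply/NW => i; apply: (bd 1).
  + by apply/NN => i; apply: (bd 2).
  + by apply/NE => i; apply: (bd 3).
  + by apply/SE => i; apply: (bd 4).
  + by apply/SS => i; apply: (bd 5).
  + exact/(all_pieces_allowedP pf).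
Qed.

(** * Binary strings and the final count *)

Lemma zeros_nth (w : seq bool) (n : nat) : n <= size w ->
  zeros (nth false w) n = n - count_mem true (take n w).
Proof.
elim: n => [|n IH] hn; first by [].
rewrite zerosS IH; last exact: ltnW.
rewrite (take_nth false hn) -cats1 count_cat /= addn0.
have := count_size (pred1 true) (take n w); rewrite size_takel; last exact: ltnW.
by case: (nth false w n) => /=; lia.
Qed.

Lemma zeros_tuple (a : nat) (w : a.-tuple bool) :
  zeros (nth false w) a = a - count_mem true w.
Proof. by rewrite zeros_nth ?size_tuple // take_oversize // size_tuple. Qed.

Lemma nth_sorted_string (a0 a1 i : nat) : i < a0 + a1 ->
  nth false (nseq a0 false ++ nseq a1 true) i = (a0 <= i).
Proof.
by move=> hi; rewrite nth_cat size_nseq !nth_nseq; case: ltnP => // h; rewrite ifT //; lia.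
Qed.

(** A string corresponds to the set of positions of its 1s. *)
Lemma card_strings (n k : nat) : #|strings n k| = 'C(n, k).
Proof.
pose supp (t : n.-tuple bool) := [set i | tnth t i].
have supp_inj : injective supp.
  move=> t t' /setP e; apply: eq_from_tnth => i.
  by have := e i; rewrite !inE.
have card_supp t : #|supp t| = count_mem true t.
  rewrite cardsE cardE size_filter -[in RHS](map_tnth_enum t) count_map enumT.
  by apply: eq_count => i; rewrite [RHS]/= eqb_id.
rewrite -[n in RHS]card_ord -card_draws -(card_imset _ supp_inj).
apply: eq_card => A; apply/imsetP/idP => [[t tk ->]|].
  by move: tk; rewrite /strings !inE card_supp.
rewrite inE => /eqP Ak; have AE : A = supp [tuple i \in A | i < n].
  by apply/setP => i; rewrite inE tnth_mktuple.
by exists [tuple i \in A | i < n] => //; rewrite inE -card_supp -AE Ak.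
Qed.

Lemma mem_strings_zeros (n k : nat) (w : n.-tuple bool) : k <= n ->
  (w \in strings n k) = (zeros (nth false w) n == n - k).
Proof.
move=> kn; rewrite inE zeros_tuple.
by have := count_size (pred1 true) w; rewrite size_tuple; lia.
Qed.

Lemma string_sortedP (a a0 a1 : nat) (s : a.-tuple bool) : a = a0 + a1 ->
  (forall i, i < a -> nth false s i = (a0 <= i)) <->
  tval s = nseq a0 false ++ nseq a1 true.
Proof.
move=> ea; split=> [H|-> i hi]; last by rewrite nth_sorted_string -?ea.
apply: (@eq_from_nth _ false); first by rewrite size_tuple size_cat !size_nseq.
by move=> i; rewrite size_tuple => hi; rewrite H // nth_sorted_string -?ea.
Qed.

Theorem theorem13 (a a0 a1 : nat) (le_a1_a : a1 <= a) (def_a0 : a0 = a - a1)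
    (alpha beta gamma delta epsilon zeta : a.-tuple bool)
    (alphaP : alpha \in strings a a1) (betaP : beta \in strings a a1)
    (gammaP : gamma \in strings a a1) (deltaP : delta \in strings a a1)
    (epsilonP : epsilon \in strings a a1) (zetaP : zeta \in strings a a1) :
  Hex alpha beta gamma delta epsilon zeta =
  let w : seq bool := nseq a0 false ++ nseq a1 true in
  if [&& tval alpha == w, tval beta == w, tval gamma == w,
         tval delta == w, tval epsilon == w & tval zeta == w]
  then 'C(a, a1)
  else 0.
Proof.
have ea : a = a0 + a1 by lia.
cbv zeta; set w := nseq a0 false ++ nseq a1 true.
pose sides := [:: alpha; beta; gamma; delta; epsilon; zeta].
have sides_strings s : s < 6 -> nth alpha sides s \in strings a a1.
  by case: s => [|[|[|[|[|[|]]]]]].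
have all_sorted p : p \in hexagonal_puzzles alpha beta gamma delta epsilon zeta ->
    forall s i, s < 6 -> i < a -> nth false (nth alpha sides s) i = (a0 <= i).
  move=> /(hexagonal_puzzlesP _ _ _ _ _ _ (edge_labelE p))[pieces bd].
  apply: (boundary_sorted (pieces_allowed_sectors pieces) bd) => s hs.
  by apply/eqP; rewrite def_a0 -mem_strings_zeros // sides_strings.
have sortedP (s : a.-tuple bool) : reflect (forall i, i < a -> nth false s i = (a0 <= i))
    (tval s == w).
  by apply: (iffP eqP) => /(string_sortedP s ea).
case: ifP => [/and5P[s0 s1 s2 s3 /andP[s4 s5]]|unsorted]; last first.
  apply/eqP; rewrite cards_eq0; apply/eqP/setP => p; rewrite in_set0.
  apply/negP => /all_sorted srt; move/negP: unsorted; apply.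
  apply/and5P; split; last apply/andP; try split; apply/sortedP => i.
  - exact: (srt 0). - exact: (srt 1). - exact: (srt 2). - exact: (srt 3).
  - exact: (srt 4). - exact: (srt 5).
have sortedE s i : s < 6 -> i < a -> nth false (nth alpha sides s) i = (a0 <= i).
  by case: s => [|[|[|[|[|[|//]]]]]] _; [move/sortedP: s0|move/sortedP: s1|
    move/sortedP: s2|move/sortedP: s3|move/sortedP: s4|move/sortedP: s5]; apply.
pose puzzle_of (t : a.-tuple bool) : labeling a :=
  [ffun e => word_label a (nth false t) (val e)].
have puzzle_ofE t e : puzzle_of t e = word_label a (nth false t) (val e).
  by rewrite ffunE.
have puzzle_inj : injective puzzle_of.
  move=> t t' e; apply/val_inj/(@eq_from_nth _ false); rewrite !size_tuple // => r hr.
  (* Letter [r] is recovered as the label of the spoke of ring [r] that starts sector 0. *)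
  have [_ h _] := sector_edge_in_hexagon (isT : 0 < 6) hr (leq0n r).
  have [_ lt _] := word_label_sector (nth false t) (isT : 0 < 6) hr (leq0n r).
  have [_ lt' _] := word_label_sector (nth false t') (isT : 0 < 6) hr (leq0n r).
  move/ffunP: e => /(_ (SeqSub h)); rewrite !puzzle_ofE.
  rewrite [val _]/(left_edge a 0 r 0) lt lt' /left_label !zerosS.
  by case: (nth false t r); case: (nth false t' r) => //=; rewrite addn1.
rewrite -card_strings -(card_imset _ puzzle_inj); apply: eq_card => p.
apply/idP/imsetP => [hp|[t]].
- have /(hexagonal_puzzlesP _ _ _ _ _ _ (edge_labelE p))[pieces bd] := hp.
  have puz := pieces_allowed_sectors pieces.
  have a0a : a0 <= a by rewrite def_a0 leq_subr.
  have [|zb labs] := sorted_puzzle_labels puz a0a.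
    by move=> s i hs hi; rewrite bd // sortedE.
  set b := (fun r => _) in zb labs.
  (* The preimage of [p] is the word of its spoke labels. *)
  pose t := [tuple b i | i < a].
  have nth_t r : r < a -> nth false t r = b r.
    by move=> hr; rewrite -(tnth_nth false t (Ordinal hr)) tnth_mktuple.
  have zt r : r <= a -> zeros (nth false t) r = zeros b r.
    by elim: r => // r IH hr; rewrite !zerosS nth_t // IH // ltnW.
  exists t. by rewrite mem_strings_zeros // zt // zb def_a0.
  apply/ffunP => e; rewrite puzzle_ofE edge_labelE.
  have [s [r [i [hs hr hi]]]] := sector_edge_exists (valP e).
  have [O A B] := labs s r i hs hr hi.
  have [O' A' B'] := word_label_sector (nth false t) hs hr hi.
  case=> -> ; [rewrite O O'|rewrite A A'|rewrite B B'];
    by rewrite /outer_label /left_label /right_label ?nth_t // zt.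
- rewrite mem_strings_zeros // => /eqP tk ->.
  apply/(hexagonal_puzzlesP _ _ _ _ _ _ (puzzle_ofE t)).
  split; first exact: word_label_pieces_allowed.
  move=> s i hs hi; have a_gt0 : 0 < a by case: (a) hi.
  have [|| -> _ _] := @word_label_sector a (nth false t) s a.-1 i hs.
  + by rewrite prednK.
  + by rewrite -ltnS prednK.
  by rewrite /outer_label prednK // tk sortedE // def_a0.
Qed.
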